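(* Let $n$ be a positive integer and $F\subseteq E(K_n)$. Then $S_F$ is a dual mutual-visibility set of $L(K_n)$ if and only if the graph $(K_n)_F$ contains neither $K_4$ nor $C_4$ as an induced subgraph.
   Context: $L(K_n)$ is the line graph of $K_n$, with vertex set $\{e_{uv}: uv\in E(K_n)\}$, $e_{uv}$ and $e_{u'v'}$ adjacent iff the edges share an endpoint. For $F\subseteq E(K_n)$, $S_F=\{e_{uv}: uv\in F\}$ and $(K_n)_F$ is the subgraph of $K_n$ with edge set $F$ and vertex set the endpoints of edges in $F$. For a connected graph $H$ and $X\subseteq V(H)$, two vertices are $X$-visible if there is a shortest path between them whose internal vertices are not in $X$; $X$ is a dual mutual-visibility set if every two vertices of $X$ are $X$-visible and every two vertices of $V(H)\setminus X$ are $X$-visible. *)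

(* Defs.v *)
From HB Require Import structures.
From mathcomp Require Import all_boot.

Set Implicit Arguments.
Unset Strict Implicit.
Unset Printing Implicit Defensive.

Record sgraph := SGraph {
  vertex :> finType;
  adj : rel vertex;
  adj_sym : symmetric adj;
  adj_irr : irreflexive adj }.

(* Edges are represented as two-element sets of vertices. *)
Definition edges (G : sgraph) : {set {set G}} :=
  [set [set p.1; p.2] | p : G * G & adj p.1 p.2].

Section Complete.
Variable n : nat.

Definition complete_adj : rel 'I_n := fun x y => x != y.

Lemma complete_adj_sym : symmetric complete_adj.
Proof. by move=> x y; rewrite /complete_adj eq_sym. Qed.

Lemma complete_adj_irr : irreflexive complete_adj.
Proof. by move=> x; rewrite /complete_adj eqxx. Qed.

Definition complete : sgraph := SGraph complete_adj_sym complete_adj_irr.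
End Complete.

Section CycleFour.
Definition C4_adj : rel 'I_4 :=
  fun x y => (x.+1 %% 4 == y) || (y.+1 %% 4 == x).

Lemma C4_adj_sym : symmetric C4_adj.
Proof. by move=> x y; rewrite /C4_adj orbC. Qed.

Lemma C4_adj_irr : irreflexive C4_adj.
Proof. by case=> [[|[|[|[|m]]]] lt_m4]. Qed.

Definition C4 : sgraph := SGraph C4_adj_sym C4_adj_irr.
End CycleFour.

Section LineGraph.
Variable G : sgraph.

Definition line_vertex : finType := {e : {set G} | e \in edges G}.

Definition line_adj : rel line_vertex :=
  fun e f => (e != f) && (val e :&: val f != set0).

Lemma line_adj_sym : symmetric line_adj.
Proof. by move=> e f; rewrite /line_adj eq_sym setIC. Qed.

Lemma line_adj_irr : irreflexive line_adj.
Proof. by move=> e; rewrite /line_adj eqxx. Qed.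

Definition line_graph : sgraph := SGraph line_adj_sym line_adj_irr.

Definition line_set (F : {set {set G}}) : {set line_graph} :=
  [set e : line_graph | val e \in F].
End LineGraph.

Section EdgeSubgraph.
Variables (G : sgraph) (F : {set {set G}}).

Definition edge_sub_vertex : finType := {x : G | x \in cover F}.

(* The conjunct [adj] is redundant when F \subset edges G; it makes the
   definition a simple graph for an arbitrary F. *)
Definition edge_sub_adj : rel edge_sub_vertex :=
  fun x y => adj (val x) (val y) && ([set val x; val y] \in F).

Lemma edge_sub_adj_sym : symmetric edge_sub_adj.
Proof. by move=> x y; rewrite /edge_sub_adj adj_sym setUC. Qed.

Lemma edge_sub_adj_irr : irreflexive edge_sub_adj.
Proof. by move=> x; rewrite /edge_sub_adj adj_irr. Qed.

Definition edge_subgraph : sgraph := SGraph edge_sub_adj_sym edge_sub_adj_irr.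
End EdgeSubgraph.

Definition has_induced (H G : sgraph) : Prop :=
  exists f : H -> G, injective f /\ forall x y, adj (f x) (f y) = adj x y.

Section Visibility.
Variable H : sgraph.

(* A path from x to y is given by the sequence p of its vertices other than
   the first one; its length is [size p]. *)
Definition is_path (x y : H) (p : seq H) : Prop :=
  [/\ path (@adj H) x p, last x p = y & uniq (x :: p)].

Definition is_shortest_path (x y : H) (p : seq H) : Prop :=
  is_path x y p /\ forall q, is_path x y q -> size p <= size q.

Definition internal_vertices (x : H) (p : seq H) : seq H :=
  behead (belast x p).

Definition visible (X : {set H}) (x y : H) : Prop :=
  exists p, is_shortest_path x y p /\
    forall z, z \in internal_vertices x p -> z \notin X.

Definition dual_mutual_visibility_set (X : {set H}) : Prop :=
  (forall x y, x \in X -> y \in X -> x != y -> visible X x y) /\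
  (forall x y, x \notin X -> y \notin X -> x != y -> visible X x y).
End Visibility.

(* Main.v *)
(** Two distinct non-adjacent vertices of [L(K_n)] are disjoint edges [ab], [cd];
    they are at distance two and their common neighbours are [ac], [ad], [bc],
    [bd].  Hence they fail to be visible exactly when these four edges all lie
    in [F].  If [ab] and [cd] are both in [F] the four vertices then induce a
    [K_4]; if both are outside [F] they induce a [C_4]. *)

From Corelib Require Import Setoid.
Require Import Defs.
From mathcomp Require Import all_boot.

Set Implicit Arguments.
Unset Strict Implicit.
Unset Printing Implicit Defensive.

(** * Visibility at distance one and two *)

Section VisibilityAtSmallDistance.
Variables (H : sgraph) (X : {set H}) (x y : H).
Hypothesis neq_xy : x != y.

Lemma is_path_size_gt0 p : is_path x y p -> 0 < size p.
Proof. by case: p => // -[_ /= eq_xy _]; move/eqP: neq_xy. Qed.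

Lemma visible_adj : adj x y -> visible X x y.
Proof.
move=> xy; exists [:: y]; split=> //; split; last by move=> q /is_path_size_gt0.
by split; rewrite //= ?xy ?inE ?neq_xy.
Qed.

Lemma is_path_size_gt1 p : ~~ adj x y -> is_path x y p -> 1 < size p.
Proof.
move=> nxy pP; have := is_path_size_gt0 pP.
case: p pP => [|z [|t p]] // [/= /andP[xz _] eq_zy _].
by rewrite -eq_zy xz in nxy.
Qed.

Lemma is_path_common_neighbour z :
  adj x z -> adj z y -> is_path x y [:: z; y].
Proof.
move=> xz zy; split; rewrite //= ?xz ?zy // !inE negb_or neq_xy andbT /= andbT.
by apply/andP; split; apply/eqP=> e; rewrite e adj_irr in xz zy.
Qed.

(** Non-adjacency bounds path lengths below by two, and the path through [z] attains this bound. A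
    shortest path is therefore [[:: w; y]], with [w] as its only internal vertex. *)
Lemma visible_dist2P z : ~~ adj x y -> adj x z -> adj z y ->
  visible X x y <-> exists w, [/\ adj x w, adj w y & w \notin X].
Proof.
move=> nxy xz zy; split=> [[p [[pP pmin] pX]]|[w [xw wy wX]]].
  have := pmin _ (is_path_common_neighbour xz zy).
  have := is_path_size_gt1 nxy pP.
  case: p pP pX {pmin} => [|w [|t [|? ?]]] // [/= /and3P[xw wt _] <- _] wX _ _.
  by exists w; split=> //; apply: wX; rewrite inE.
exists [:: w; y]; split; last by move=> t; rewrite inE => /eqP->.
by split=> [|q /(is_path_size_gt1 nxy)] //; apply: is_path_common_neighbour.
Qed.

End VisibilityAtSmallDistance.

(** * Induced copies in an edge subgraph, and quadruples of distinct elements *)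

Lemma pair_in_cover (T : finType) (F : {set {set T}}) (a b : T) :
  [set a; b] \in F -> (a \in cover F) && (b \in cover F).
Proof.
by move=> abF; apply/andP; split; apply/bigcupP;
  exists [set a; b]; rewrite // !inE eqxx ?orbT.
Qed.

(** Removes the subtype of covered vertices, so that a copy can be given by a plain map into [G]. *)
Lemma has_induced_edge_subgraphP (G H : sgraph) (F : {set {set G}}) :
  has_induced H (edge_subgraph F) <->
  exists g : H -> G, [/\ injective g, forall i, g i \in cover F &
    forall i j, adj (g i) (g j) && ([set g i; g j] \in F) = adj i j].
Proof.
split=> [[f [f_inj f_adj]]|[g [g_inj gF g_adj]]].
  exists (fun i => val (f i)); split=> [i j /val_inj/f_inj|i|i j] //.
  - exact: valP.
  - exact: f_adj.
exists (fun i => Sub (g i) (gF i) : edge_subgraph F); split=> [i j|i j].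
  by move/(congr1 val)=> /= /g_inj.
exact: g_adj.
Qed.

Lemma forall_I4 (P : 'I_4 -> Prop) :
  P (inord 0) -> P (inord 1) -> P (inord 2) -> P (inord 3) -> forall i, P i.
Proof.
move=> P0 P1 P2 P3 i; rewrite -(inord_val i).
by case: i => -[|[|[|[|m]]]].
Qed.

(** Together with [uniq_swapr], this lets the endpoints of either of two disjoint edges be
    exchanged. *)
Lemma uniq_swapl (T : eqType) (a b c d : T) :
  uniq [:: b; a; c; d] = uniq [:: a; b; c; d].
Proof. exact/perm_uniq/permEl/(perm_catCA [:: b] [:: a]). Qed.

Lemma uniq_swapr (T : eqType) (a b c d : T) :
  uniq [:: a; b; d; c] = uniq [:: a; b; c; d].
Proof. by apply/perm_uniq; rewrite !perm_cons (perm_catC [:: d] [:: c]). Qed.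

Lemma uniq4_tnth_inj (T : eqType) (a b c d : T) :
  uniq [:: a; b; c; d] -> injective (tnth [tuple a; b; c; d]).
Proof. by move=> u; apply/tuple_uniqP. Qed.

Lemma inj_uniq4 (T : eqType) (g : 'I_4 -> T) (i j k l : 'I_4) :
  injective g -> uniq [:: i; j; k; l] -> uniq [:: g i; g j; g k; g l].
Proof. by move=> g_inj; rewrite -(map_inj_uniq g_inj). Qed.

(** * Disjoint edges of $K_n$ and their common neighbours in the line graph *)

Section LineGraphOfComplete.
Variable n : nat.
Implicit Types (F : {set {set complete n}}) (a b c d : complete n).
Implicit Types x y z : line_graph (complete n).

Lemma complete_adjE k (i j : complete k) : adj i j = (i != j).
Proof. by []. Qed.

Lemma edges_completeP (e : {set complete n}) :
  reflect (exists a b, a != b /\ e = [set a; b]) (e \in edges (complete n)).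
Proof.
apply: (iffP imsetP) => [[[a b]]|[a [b [neq_ab ->]]]].
  by rewrite inE /= => neq_ab ->; exists a, b.
by exists (a, b); rewrite ?inE.
Qed.

Lemma line_vertexP x : exists a b, a != b /\ val x = [set a; b].
Proof. exact/edges_completeP/(valP x). Qed.

Lemma line_vertex_of a b :
  a != b -> exists x, val x = [set a; b].
Proof.
move=> neq_ab; have abE : [set a; b] \in edges (complete n).
  by apply/edges_completeP; exists a, b.
by exists (Sub [set a; b] abE).
Qed.

Lemma line_adjP x y :
  reflect (x != y /\ exists2 a, a \in val x & a \in val y) (adj x y).
Proof.
rewrite /adj /= /line_adj; apply: (iffP andP) => -[neq_xy xy]; split=> //.
  by case/set0Pn: xy => a /setIP[ax ay]; exists a.
by case: xy => a ax ay; apply/set0Pn; exists a; rewrite inE ax ay.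
Qed.

(** For distinct vertices, these are the sides of the 4-cycle $a, c, b, d$, whose diagonals are $ab$
    and $cd$. *)
Definition crossing F a b c d :=
  [&& [set a; c] \in F, [set a; d] \in F, [set b; c] \in F & [set b; d] \in F].

Lemma disjoint_edges_nadj x y a b c d :
    val x = [set a; b] -> val y = [set c; d] -> uniq [:: a; b; c; d] ->
  x != y /\ ~~ adj x y.
Proof.
move=> xE yE; rewrite /= !inE !negb_or.
move=> /and4P[/and3P[_ ac ad] /andP[bc bd] _ _]; split.
  apply/eqP=> xy; have: a \in val y by rewrite -xy xE !inE eqxx.
  by rewrite yE !inE (negPf ac) (negPf ad).
apply/line_adjP=> -[_ [t]]; rewrite xE yE !inE => /orP[]/eqP->.
  by rewrite (negPf ac) (negPf ad).
by rewrite (negPf bc) (negPf bd).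
Qed.

Lemma nadj_disjoint_edges x y : x != y -> ~~ adj x y ->
  exists a b c d,
    [/\ val x = [set a; b], val y = [set c; d] & uniq [:: a; b; c; d]].
Proof.
move=> neq_xy nxy; have [a [b [ab xE]]] := line_vertexP x.
have [c [d [cd yE]]] := line_vertexP y; exists a, b, c, d; split=> //.
have disj t : t \in val x -> t \in val y -> False.
  by move=> tx ty; case/line_adjP: nxy; split=> //; exists t.
have xa : a \notin val y by apply/negP/disj; rewrite xE !inE eqxx.
have xb : b \notin val y by apply/negP/disj; rewrite xE !inE eqxx orbT.
move: xa xb; rewrite yE /= !inE !negb_or => -> ->.
by rewrite ab cd.
Qed.

(* [ac] meets [ab] in [a] and is distinct from it because it contains [c]. *)
Lemma crossing_adj x z a b c :
    val x = [set a; b] -> val z = [set a; c] -> c != a -> c != b ->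
  adj x z.
Proof.
move=> xE zE ca cb; apply/line_adjP; split; last first.
  by exists a; rewrite ?xE ?zE !inE eqxx.
apply/eqP=> xz; have: c \in val x by rewrite xz zE !inE eqxx orbT.
by rewrite xE !inE (negPf ca) (negPf cb).
Qed.

Lemma disjoint_edges_common_neighbour x y z a b c d :
    val x = [set a; b] -> val y = [set c; d] -> uniq [:: a; b; c; d] ->
    val z = [set a; c] ->
  adj x z /\ adj z y.
Proof.
move=> xE yE; rewrite !cons_uniq !inE !negb_or.
move=> /and4P[/and3P[ab ac ad] /andP[bc bd] cd _] zE; split.
  by apply: (crossing_adj xE zE); rewrite eq_sym.
by rewrite adj_sym; apply: (crossing_adj yE _ ac ad); rewrite zE setUC.
Qed.

(** A common neighbour contains an endpoint [s] of one edge and an endpoint [t] of the other. These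
    differ because the edges are disjoint, so they determine it. *)
Lemma common_neighbourE x y z a b c d :
    val x = [set a; b] -> val y = [set c; d] -> uniq [:: a; b; c; d] ->
    adj x z -> adj z y ->
  val z \in [:: [set a; c]; [set a; d]; [set b; c]; [set b; d]].
Proof.
move=> xE yE uabcd /line_adjP[_ [s sx sz]] /line_adjP[_ [t tz ty]].
have neq_st : s != t.
  have [neq_xy /line_adjP nxy] := disjoint_edges_nadj xE yE uabcd.
  by apply/eqP=> st; apply: nxy; split=> //; exists s; rewrite // st.
have zE : val z = [set s; t].
  have [u [v [neq_uv zE]]] := line_vertexP z.
  (* One inclusion suffices, since both sets have two elements. *)
  apply/esym/eqP; rewrite eqEcard subUset !sub1set sz tz /=.
  by rewrite zE !cards2 neq_uv neq_st.
rewrite zE; move: sx ty; rewrite xE yE !inE.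
by case/orP=> /eqP-> /orP[]/eqP->; rewrite eqxx ?orbT.
Qed.

Lemma disjoint_edges_visibleP F x y a b c d :
    val x = [set a; b] -> val y = [set c; d] -> uniq [:: a; b; c; d] ->
  visible (line_set F) x y <-> ~~ crossing F a b c d.
Proof.
move=> xE yE uabcd.
have [neq_xy nxy] := disjoint_edges_nadj xE yE uabcd.
have xE' : val x = [set b; a] by rewrite setUC.
have yE' : val y = [set d; c] by rewrite setUC.
(* All four crossing edges are common neighbours: exchanging endpoints within [x] or [y] reduces
   each case to that of $ac$. *)
have cross s t : s \in [set a; b] -> t \in [set c; d] ->
    exists z, [/\ val z = [set s; t], adj x z & adj z y].
  move=> sab tcd; have neq_st : s != t.
    move: uabcd sab tcd; rewrite /= !inE !negb_or.
    by case/and4P=> /and3P[_ ? ?] /andP[? ?] _ _ /orP[]/eqP-> /orP[]/eqP->.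
  have [z zE] := line_vertex_of neq_st; exists z.
  suff [] : adj x z /\ adj z y by split.
  move: sab tcd zE; rewrite !inE => /orP[]/eqP-> /orP[]/eqP->.
  - exact: (disjoint_edges_common_neighbour xE yE).
  - by apply: (disjoint_edges_common_neighbour xE yE'); rewrite uniq_swapr.
  - by apply: (disjoint_edges_common_neighbour xE' yE); rewrite uniq_swapl.
  - by apply: (disjoint_edges_common_neighbour xE' yE');
      rewrite uniq_swapl uniq_swapr.
(* The edge $ac$ serves only to certify that the distance is two. *)
have [z [_ xz zy]] : exists z, [/\ val z = [set a; c], adj x z & adj z y].
  by apply: cross; rewrite !inE eqxx.
rewrite (visible_dist2P _ neq_xy nxy xz zy); split=> [[w [xw wy wF]]|].
  apply: contra wF; rewrite inE => /and4P[ac ad bc bd].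
  have := common_neighbourE xE yE uabcd xw wy.
  by rewrite !inE => /or4P[]/eqP->.
rewrite /crossing !negb_and => ncross.
have [s [t [sab tcd stF]]] : exists s t,
    [/\ s \in [set a; b], t \in [set c; d] & [set s; t] \notin F].
  by case/or4P: ncross;
    [exists a, c | exists a, d | exists b, c | exists b, d];
    split; rewrite // !inE eqxx ?orbT.
by have [w [wE xw wy]] := cross s t sab tcd; exists w; rewrite inE wE.
Qed.

(** Adjacent vertices are always visible, so only disjoint edges impose a condition. Equality of the
    two memberships covers both halves of the definition at once. *)
Lemma dual_mutual_visibility_line_setP F :
  dual_mutual_visibility_set (line_set F) <->
  forall a b c d, uniq [:: a; b; c; d] ->
    ([set a; b] \in F) = ([set c; d] \in F) -> ~~ crossing F a b c d.
Proof.
split=> [[visF visNF] a b c d uabcd eqF|ncross].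
  have [ab cd] : a != b /\ c != d.
    by move: uabcd; rewrite /= !inE !negb_or => /and4P[/and3P[-> _ _] _ -> _].
  have [x xE] := line_vertex_of ab; have [y yE] := line_vertex_of cd.
  have [neq_xy _] := disjoint_edges_nadj xE yE uabcd.
  apply/(disjoint_edges_visibleP F xE yE uabcd).
  case: (boolP ([set a; b] \in F)) => abF.
    by apply: visF; rewrite ?inE ?xE ?yE -?eqF.
  by apply: visNF; rewrite ?inE ?xE ?yE -?eqF.
suff vis x y : x != y -> (val x \in F) = (val y \in F) ->
    visible (line_set F) x y.
  split=> x y; rewrite !inE => xF yF neq_xy; apply: vis => //.
    by rewrite xF yF.
  by rewrite (negPf xF) (negPf yF).
move=> neq_xy; case: (boolP (adj x y)) => [xy _|nxy]; first exact: visible_adj.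
have [a [b [c [d [xE yE uabcd]]]]] := nadj_disjoint_edges neq_xy nxy.
rewrite xE yE => eqF; apply/(disjoint_edges_visibleP F xE yE uabcd).
exact: ncross.
Qed.

(** The six edges of $K_4$ split into the perfect matching $ab$, $cd$ and the four crossing
    edges. *)
Lemma has_induced_K4P F :
  has_induced (complete 4) (edge_subgraph F) <->
  exists a b c d, [/\ uniq [:: a; b; c; d], [set a; b] \in F,
    [set c; d] \in F & crossing F a b c d].
Proof.
rewrite has_induced_edge_subgraphP.
split=> [[g [g_inj _ gF]]|[a [b [c [d [uabcd abF cdF cross]]]]]].
  have gP i j : i != j -> [set g i; g j] \in F.
    by move=> ij; have := gF i j; rewrite (complete_adjE i) ij => /andP[].
  exists (g (inord 0)), (g (inord 1)), (g (inord 2)), (g (inord 3)); split.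
  - by apply: inj_uniq4; rewrite //= !inE -!val_eqE /= !inordK.
  - by apply: gP; rewrite -val_eqE /= !inordK.
  - by apply: gP; rewrite -val_eqE /= !inordK.
  - by apply/and4P; split; apply: gP; rewrite -val_eqE /= !inordK.
have g_inj := uniq4_tnth_inj uabcd.
case/and4P: cross => acF adF bcF bdF.
have [aF bF] := andP (pair_in_cover abF).
have [cF dF] := andP (pair_in_cover cdF).
exists (tnth [tuple a; b; c; d]); split=> // [|i j].
  by apply: forall_I4; rewrite (tnth_nth a) inordK.
rewrite !complete_adjE (inj_eq g_inj).
case: eqVneq => //= neq_ij; move: i j neq_ij.
(* Sixteen index pairs are checked; [setUC] settles those whose edge is listed in the opposite
   order. *)
by apply: forall_I4; apply: forall_I4;
  rewrite ?eqxx // !(tnth_nth a) !inordK //= => _; rewrite // setUC.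
Qed.

(* The cycle visits the vertices in the order [a], [c], [b], [d]. *)
Lemma has_induced_C4P F :
  has_induced C4 (edge_subgraph F) <->
  exists a b c d, [/\ uniq [:: a; b; c; d], [set a; b] \notin F,
    [set c; d] \notin F & crossing F a b c d].
Proof.
rewrite has_induced_edge_subgraphP.
split=> [[g [g_inj _ gF]]|[a [b [c [d [uabcd abF cdF cross]]]]]].
  have gP (i j : 'I_4) : i != j -> ([set g i; g j] \in F) = C4_adj i j.
    move=> ij; have := gF i j.
    by rewrite complete_adjE (inj_eq g_inj) ij.
  (* Indices 0 and 2 are opposite on the cycle, as are 1 and 3, so these pairs become the missing
     diagonals $ab$ and $cd$. *)
  exists (g (inord 0)), (g (inord 2)), (g (inord 1)), (g (inord 3)); split.
  - by apply: inj_uniq4; rewrite //= !inE -!val_eqE /= !inordK.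
  - by rewrite gP /C4_adj -?val_eqE /= !inordK.
  - by rewrite gP /C4_adj -?val_eqE /= !inordK.
  - by rewrite /crossing !gP /C4_adj -?val_eqE /= ?inordK.
have uacbd : uniq [:: a; c; b; d].
  by rewrite -(perm_uniq (_ : perm_eq [:: a; b; c; d] _)) // perm_cons
    (perm_catCA [:: b] [:: c]).
have g_inj := uniq4_tnth_inj uacbd.
case/and4P: cross => acF adF bcF bdF.
have [aF cF] := andP (pair_in_cover acF).
have [bF dF] := andP (pair_in_cover bdF).
exists (tnth [tuple a; c; b; d]); split=> // [|i j].
  by apply: forall_I4; rewrite (tnth_nth a) inordK.
rewrite complete_adjE (inj_eq g_inj).
case: eqVneq => [->|neq_ij] /=; first by rewrite C4_adj_irr.
move: i j neq_ij.
by apply: forall_I4; apply: forall_I4;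
  rewrite ?eqxx // !(tnth_nth a) /C4_adj !inordK //= => _;
  rewrite ?(negPf abF) ?(negPf cdF) // setUC ?(negPf abF) ?(negPf cdF).
Qed.

End LineGraphOfComplete.

Theorem theorem3p12 (n : nat) (hn : 0 < n) (F : {set {set complete n}})
    (hF : F \subset edges (complete n)) :
  dual_mutual_visibility_set (line_set F) <->
  ~ has_induced (complete 4) (edge_subgraph F) /\
  ~ has_induced C4 (edge_subgraph F).
Proof.
rewrite dual_mutual_visibility_line_setP has_induced_K4P has_induced_C4P.
split=> [ncross|[nK4 nC4] a b c d uabcd eqF].
  split=> -[a [b [c [d [uabcd abF cdF]]]]]; apply/negP/ncross => //.
    by rewrite abF cdF.
  by rewrite (negPf abF) (negPf cdF).
(* By [eqF], the case chosen for $ab$ also holds for $cd$, so the mixed cases never arise. *)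
apply/negP=> cross; case: (boolP ([set a; b] \in F)) => abF.
  by apply: nK4; exists a, b, c, d; rewrite -eqF abF.
by apply: nC4; exists a, b, c, d; rewrite -eqF.
Qed.
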